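(* For every positive rational number $x\in\mathbb{Q}_{>0}$, whose even-length continued fraction expansion is $[a_0;a_1,\dots,a_{2\ell-1}]$, the cardinality statistics over the set $\mathcal{J}(x)$ of order ideals of the fence poset $\mathcal{F}(x)$ satisfies \[ \left(\begin{array}{r} \sum_{I\in \mathcal{J}^\bullet(x)} q^{|I|}\\ \sum_{I\in \mathcal{J}^\circ(x)} q^{|I|} \end{array}\right) = \left(\begin{smallmatrix} 1 & 0 \\ 0 & q \end{smallmatrix}\right)^{-1} R_q^{a_0}L_q^{a_1}\cdots R_q^{a_{2\ell-2}}L_q^{a_{2\ell-1}} \left(\begin{smallmatrix} 1 \\ 0 \end{smallmatrix}\right). \]
   Context: Here $q$ is an indeterminate, $L_q=\left(\begin{smallmatrix} q & 0\\ q & 1\end{smallmatrix}\right)$, $R_q=\left(\begin{smallmatrix} q & 1\\ 0 & 1\end{smallmatrix}\right)$, and the even-length expansion has $a_0\ge0$, $a_i\ge1$ for $i\ge1$. Let $W(x)=\mathtt{1}^{a_0}\mathtt{0}^{a_1}\cdots\mathtt{1}^{a_{2\ell-2}}\mathtt{0}^{a_{2\ell-1}-1}\in\{\mathtt{0},\mathtt{1}\}^*$. For a word $w=w_1\cdots w_n$, the fence poset $F(w)$ has elements $y_0,\dots,y_n$ with covering relations $y_{i-1}\lhd y_i$ if $w_i=\mathtt{0}$ and $y_{i-1}\rhd y_i$ if $w_i=\mathtt{1}$. Set $\mathcal{F}(x)=F(W(x))$, and $\mathcal{J}(x)$ the set of lower order ideals of $\mathcal{F}(x)$, partitioned into $\mathcal{J}^\bullet(x)=\{I\mid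 y_0\in I\}$ and $\mathcal{J}^\circ(x)=\{I\mid y_0\notin I\}$; $|I|$ is the cardinality of $I$.
   Formalization: The fence order is reversed: y_{i-1} covers y_i if w_i=0 and is covered by y_i if w_i=1. With ◁ read as ''is covered by'' the identity fails, e.g. x=2=[1;1] gives (q^2, 1+q) on the left but (q^2+q, 1) on the right. *)

(* Defs.v *)
(* MathComp *)
From HB Require Import structures.
From mathcomp Require Import all_boot all_order all_algebra.

Set Implicit Arguments.
Unset Strict Implicit.
Unset Printing Implicit Defensive.

Import Order.TTheory GRing.Theory Num.Theory.
Local Open Scope ring_scope.

(* The field Q(q) of rational functions in the indeterminate q. *)
Notation Qq := {fraction {poly rat}}.
Definition q : Qq := @tofrac {poly rat} 'X.

Definition mx2 (a b c d : Qq) : 'M[Qq]_2 :=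
  \matrix_(i, j) (nth [::] [:: [:: a; b]; [:: c; d]] i)`_j.
Definition cv2 (a b : Qq) : 'cV[Qq]_2 := \col_i [:: a; b]`_i.

Definition Lq : 'M[Qq]_2 := mx2 q 0
                                q 1.
Definition Rq : 'M[Qq]_2 := mx2 q 1
                                0 1.

(* [cf_val [:: a0; a1; ...; an]] is a0 + 1/(a1 + 1/(... + 1/an)); the innermost
   term is an + 0^-1 = an. *)
Fixpoint cf_val (a : seq nat) : rat :=
  if a is a0 :: a' then a0%:R + (cf_val a')^-1 else 0.

(* x = [a_0; a_1, ..., a_(2l-1)] with a_0 >= 0 and a_i >= 1 for i >= 1. *)
Definition even_cf (x : rat) (l : nat) (a : seq nat) : Prop :=
  [/\ (0 < l)%N, size a = (2 * l)%N, all (leq 1) (behead a) & cf_val a = x].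

(* Words over {0,1}: the letter 1 is [true] and the letter 0 is [false].
   [cf_word a] is 1^a_0 0^a_1 ... 1^a_(2l-2) 0^(a_(2l-1) - 1): the subtracted
   boolean is 1 exactly at the last index. *)
Definition cf_word (a : seq nat) : seq bool :=
  flatten (mkseq (fun i => nseq (nth 0%N a i - (i.+1 == size a)) (~~ odd i))
                 (size a)).

(* The element y_i of the fence poset of w is the ordinal i, and the letter w_i
   (numbered from 1) is [nth _ w i.-1]. *)
Definition fence (w : seq bool) : Type := 'I_(size w).+1.

(* The triangle relation y_(i-1) <| y_i if w_i = 0, y_(i-1) |> y_i if w_i = 1,
   where u <| v means "u covers v": the letter 0 is a descent and the letter 1
   an ascent. This orientation is forced by the matrix identity on lower ideals:
   for x = 2 = [1; 1], w = 1, the right-hand side is (q^2 + q, 1), which is what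
   y_0 < y_1 gives, whereas y_0 > y_1 would give (q^2, 1 + q). *)
Definition fence_covers (w : seq bool) : rel 'I_(size w).+1 :=
  fun u v => ((v == u.+1 :> nat) && ~~ nth false w u)
          || ((u == v.+1 :> nat) && nth false w v).

Definition fence_le (w : seq bool) : rel 'I_(size w).+1 :=
  fun u v => connect (@fence_covers w) v u.

Lemma fence_le_refl w : reflexive (@fence_le w).
Proof. by move=> u; apply: connect0. Qed.

Lemma fence_le_trans w : transitive (@fence_le w).
Proof. by move=> v u t uv vt; apply: connect_trans vt uv. Qed.

Lemma fence_le_anti w : antisymmetric (@fence_le w).
Proof.
pose h i := (count id (take i w) + count negb (drop i w))%N.
have hS i : (i < size w)%N ->
    if nth false w i then h i.+1 = (h i).+1 else h i = (h i.+1).+1.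
  move=> ltiw; rewrite /h (take_nth false ltiw) (drop_nth false ltiw).
  rewrite -cats1 count_cat /= addn0.
  by case: (nth false w i); rewrite /= ?addn0 ?addn1 ?addnS.
have hlt u v : @fence_covers w u v -> (h v < h u)%N.
  case/orP => /andP[/eqP e wi].
    have lt : (u < size w)%N by have := ltn_ord v; rewrite e ltnS.
    by have := hS u lt; rewrite (negPf wi) e => ->.
  have lt : (v < size w)%N by have := ltn_ord u; rewrite e ltnS.
  by have := hS v lt; rewrite wi e => ->.
have hle u v : connect (@fence_covers w) u v -> (u == v) || (h v < h u)%N.
  case/connectP => p; elim: p u => [|t p IH] u /= => [_ ->|].
    by rewrite eqxx.
  by case/andP => /hlt ut /IH{}IH /IH /orP[/eqP<-|tv]; apply/orP; right;
    last exact: ltn_trans tv ut.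
move=> u v /andP[/hle/orP[/eqP->//|uv] /hle/orP[/eqP->//|vu]].
by have := ltn_trans uv vu; rewrite ltnn.
Qed.

Fact fence_display : Order.disp_t. Proof. exact: Order.Disp tt tt. Qed.

HB.instance Definition _ w := Finite.on (fence w).
HB.instance Definition _ w := Order.Le_isPOrder.Build fence_display (fence w)
  (@fence_le_refl w) (@fence_le_anti w) (@fence_le_trans w).

Definition y0 (w : seq bool) : fence w := ord0.

Definition lower_ideals (d : Order.disp_t) (P : finPOrderType d) :
    {set {set P}} :=
  [set I : {set P} | [forall u in I, [forall v, (v <= u)%O ==> (v \in I)]]].

(* Main.v *)
(* Splitting off y_0, an order ideal of F(b w) is an order ideal of F(w) with
   the choice of whether y_0 belongs to it, constrained only by y_1.  Hence the
   pair (A, B) of generating functions over J^bullet and J^circ becomes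
   (q(A+B), B) when the letter 1 is prepended and (qA, A+B) when 0 is.
   In the coordinates (A, qB) these two maps are R_q and L_q, and the
   one-element poset has (A, qB) = (q, q) = L_q (1, 0)^T, which supplies the
   last factor L_q. *)
Require Import Defs.
From HB Require Import structures.
From mathcomp Require Import all_boot all_order all_algebra.

Set Implicit Arguments.
Unset Strict Implicit.
Unset Printing Implicit Defensive.

Import Order.TTheory GRing.Theory Num.Theory.
Local Open Scope ring_scope.

(** Encodes a subset of F(b w): a boolean for y_0, and the rest pulled back along [lift ord0], which
    identifies F(w) with y_1, y_2, ... by shifting indices. *)
Definition cons_set n (b : bool) (I : {set 'I_n}) : {set 'I_n.+1} :=
  [set i | if unlift ord0 i is Some j then j \in I else b].

Lemma mem_cons_set0 n b (I : {set 'I_n}) : (ord0 \in cons_set b I) = b.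
Proof. by rewrite inE unlift_none. Qed.

Lemma mem_cons_set_lift n b (I : {set 'I_n}) j :
  (lift ord0 j \in cons_set b I) = (j \in I).
Proof. by rewrite inE liftK. Qed.

Lemma card_cons_set n b (I : {set 'I_n}) : #|cons_set b I| = (b + #|I|)%N.
Proof.
rewrite -!sum1_card big_mkcond big_ord_recl mem_cons_set0 [in RHS]big_mkcond /=.
by congr addn; apply: eq_bigr => j _; rewrite mem_cons_set_lift.
Qed.

Lemma big_set_ord_recl (R : nmodType) n (P : pred {set 'I_n.+1})
    (F : {set 'I_n.+1} -> R) :
  \sum_(I | P I) F I =
    \sum_(I | P (cons_set true I)) F (cons_set true I) +
    \sum_(I | P (cons_set false I)) F (cons_set false I).
Proof.
transitivity (\sum_b \sum_(I | P (cons_set b I)) F (cons_set b I));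
  last by rewrite big_bool.
rewrite pair_big_dep /= (reindex (fun p => cons_set p.1 p.2)) //=.
exists (fun I : {set 'I_n.+1} =>
          (ord0 \in I, [set j : 'I_n | lift ord0 j \in I]))
  => [[b I] _ | I _] /=.
  rewrite mem_cons_set0; congr pair; apply/setP => j.
  by rewrite inE mem_cons_set_lift.
apply/setP => i; case: (unliftP ord0 i) => [j|] ->.
  by rewrite mem_cons_set_lift inE.
by rewrite mem_cons_set0.
Qed.

(** The order is the reflexive transitive closure of the covers, so closure propagates along a path
    of covers. *)
Lemma lower_ideals_fenceP w (I : {set fence w}) :
  reflect (forall u v, @fence_covers w u v -> u \in I -> v \in I)
          (I \in lower_ideals (fence w)).
Proof.
rewrite inE; apply: (iffP forall_inP) => [idI u v uv uI | clI u uI].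
  by have /forallP/(_ v)/implyP := idI u uI; apply; apply: connect1.
apply/forallP => v; apply/implyP => /connectP[p].
elim: p u uI => [|t p IHp] u uI /=; first by move=> _ ->.
by case/andP => /clI/(_ uI)/IHp.
Qed.

(** The covers of F(b w) are the shifted covers of F(w) and one between y_0 and y_1; the latter puts
    y_0 below y_1 exactly when b is the letter 1. *)
Lemma cons_set_lower_ideal b c w (I : {set fence w}) :
  (cons_set c I \in lower_ideals (fence (b :: w))) =
  (if b then (y0 w \in I) ==> c else c ==> (y0 w \in I))
  && (I \in lower_ideals (fence w)).
Proof.
apply/lower_ideals_fenceP/andP => [clI | [cI /lower_ideals_fenceP clI] u v].
  split.
    case: b clI => clI; apply/implyP.
      have := clI (lift ord0 (y0 w)) ord0 isT.
      by rewrite mem_cons_set_lift mem_cons_set0.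
    have := clI ord0 (lift ord0 (y0 w)) isT.
    by rewrite mem_cons_set_lift mem_cons_set0.
  apply/lower_ideals_fenceP => u v uv.
  (* Shifting both indices skips the head letter by computation, so [uv] also proves the lifted
     cover. *)
  by have := clI (lift ord0 u) (lift ord0 v) uv; rewrite !mem_cons_set_lift.
case: (unliftP ord0 u) => [u'|] ->; case: (unliftP ord0 v) => [v'|] ->;
  rewrite ?mem_cons_set_lift ?mem_cons_set0 //; first exact: clI.
- rewrite /fence_covers /= /bump /= !add1n eqSS => /andP[/eqP u0 bT].
  by move: cI; rewrite bT (_ : u' = y0 w) => [/implyP|]; last exact: val_inj.
- rewrite /fence_covers /= /bump /= !add1n eqSS orbF => /andP[/eqP v0 bF].
  move: cI; rewrite (negPf bF) (_ : v' = y0 w) => [/implyP //|].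
  exact: val_inj.
Qed.

Section GeneratingFunctions.
Variables (R : nzRingType) (t : R).

Definition ideal_gf_in w : R :=
  \sum_(I in lower_ideals (fence w) | y0 w \in I) t ^+ #|I|.
Definition ideal_gf_out w : R :=
  \sum_(I in lower_ideals (fence w) | y0 w \notin I) t ^+ #|I|.

Lemma ideal_gf_total w :
  \sum_(I in lower_ideals (fence w)) t ^+ #|I| = ideal_gf_in w + ideal_gf_out w.
Proof. exact: bigID. Qed.

(** The factor [t] counts y_0. With y_0 in the ideal, the letter 1 leaves y_1 free, while the letter
    0 forces y_1 in. *)
Lemma ideal_gf_in_cons b w :
  ideal_gf_in (b :: w) =
  t * (ideal_gf_in w + if b then ideal_gf_out w else 0).
Proof.
rewrite /ideal_gf_in big_set_ord_recl [X in _ + X]big_pred0 => [|I];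
  last by rewrite mem_cons_set0 andbF.
rewrite addr0; under eq_bigr do rewrite card_cons_set exprS.
rewrite -mulr_sumr; congr (t * _); case: b.
  rewrite -[RHS]ideal_gf_total; apply: eq_bigl => I.
  by rewrite cons_set_lower_ideal mem_cons_set0 implybT andbT.
rewrite addr0; apply: eq_bigl => I.
by rewrite cons_set_lower_ideal mem_cons_set0 andbT andbC.
Qed.

(** Dually, with y_0 left out, the letter 1 forces y_1 out, while the letter 0 leaves y_1 free. *)
Lemma ideal_gf_out_cons b w :
  ideal_gf_out (b :: w) =
  (if b then 0 else ideal_gf_in w) + ideal_gf_out w.
Proof.
rewrite /ideal_gf_out big_set_ord_recl big_pred0 => [|I];
  last by rewrite mem_cons_set0 andbF.
rewrite add0r; under eq_bigr do rewrite card_cons_set add0n.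
case: b.
  rewrite add0r; apply: eq_bigl => I.
  by rewrite cons_set_lower_ideal mem_cons_set0 andbT implybF andbC.
rewrite -[RHS]ideal_gf_total; apply: eq_bigl => I.
by rewrite cons_set_lower_ideal mem_cons_set0 andbT.
Qed.

Lemma lower_ideals_fence_nil (I : {set fence [::]}) :
  I \in lower_ideals (fence [::]).
Proof.
by apply/lower_ideals_fenceP => u v _; rewrite (ord1 u) (ord1 v).
Qed.

(** Serves the one-element fence: nothing but [set0] remains once y_0 is split off. *)
Lemma sum_set_ord0 (P : pred {set 'I_0}) (F : {set 'I_0} -> R) :
  \sum_(I | P I) F I = if P set0 then F set0 else 0.
Proof.
rewrite big_mkcond (big_pred1 set0) // => I.
by apply/esym/eqP/setP => -[].
Qed.

Lemma ideal_gf_in_nil : ideal_gf_in [::] = t.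
Proof.
rewrite /ideal_gf_in big_set_ord_recl !sum_set_ord0 !mem_cons_set0.
by rewrite lower_ideals_fence_nil andbF card_cons_set cards0 addr0.
Qed.

Lemma ideal_gf_out_nil : ideal_gf_out [::] = 1.
Proof.
rewrite /ideal_gf_out big_set_ord_recl !sum_set_ord0 !mem_cons_set0.
by rewrite !lower_ideals_fence_nil /= card_cons_set cards0 add0r.
Qed.

End GeneratingFunctions.

Lemma mx2_mul_cv2 a b c d u v :
  mx2 a b c d *m cv2 u v = cv2 (a * u + b * v) (c * u + d * v).
Proof.
apply/matrixP => i j; rewrite !mxE big_ord_recl big_ord1 !mxE /=.
by case: i => [[|[|]]].
Qed.

Definition letter_mx (b : bool) : 'M[Qq]_2 := if b then Rq else Lq.

Lemma ideal_gf_word w :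
  cv2 (ideal_gf_in q w) (q * ideal_gf_out q w) =
  (\prod_(b <- w) letter_mx b) *m (Lq *m cv2 1 0).
Proof.
elim: w => [|b w IHw].
  rewrite ideal_gf_in_nil ideal_gf_out_nil big_nil mul1mx mx2_mul_cv2.
  by rewrite !mulr0 !mulr1 !addr0.
rewrite big_cons -mulmxA -IHw ideal_gf_in_cons ideal_gf_out_cons.
by case: b; rewrite mx2_mul_cv2 ?mul0r ?mul1r ?add0r ?addr0 mulrDr.
Qed.

Lemma prod_letter_mx_nseq n b :
  \prod_(c <- nseq n b) letter_mx c = letter_mx b ^+ n.
Proof. by rewrite big_nseq iter_mulr_1. Qed.

Lemma prod_nat_pairs (R : pzSemiRingType) n (G : nat -> R) :
  \prod_(0 <= i < 2 * n) G i =
  \prod_(i < n) (G (2 * i)%N * G (2 * i).+1).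
Proof.
elim: n => [|n IHn]; first by rewrite big_geq // big_ord0.
by rewrite mulnS !big_nat_recr //= IHn big_ord_recr /= mulrA.
Qed.

(** The word stops one letter 0 short of the full expansion; the extra [Lq] on the right restores
    the last exponent. *)
Lemma prod_cf_word l (a : seq nat) :
  size a = (2 * l.+1)%N -> all (leq 1) (behead a) ->
  (\prod_(b <- cf_word a) letter_mx b) * Lq =
  \prod_(i < l.+1) (Rq ^+ nth 0%N a (2 * i) * Lq ^+ nth 0%N a (2 * i).+1).
Proof.
move=> sz_a a_ge1; rewrite /cf_word sz_a.
(* The last index is positive, so its entry is at least 1 and the truncated subtraction in [cf_word]
   really removes a letter. *)
have last_a : (0 < nth 0%N a (2 * l).+1)%N.
  rewrite -nth_behead; have /all_nthP := a_ge1; apply.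
  by rewrite size_behead sz_a mulnS.
rewrite big_flatten /mkseq big_map.
under eq_bigr do rewrite prod_letter_mx_nseq.
rewrite -[X in iota _ X]subn0 -/(index_iota _ _).
(* Three goals: the earlier pairs, the even index of the last pair, and the final index, the only
   one where 1 is subtracted. *)
rewrite prod_nat_pairs !big_ord_recr /= -!mulrA; congr (_ * (_ * _)).
- apply: eq_bigr => i _.
  have lt_il : (2 * i < 2 * l)%N by rewrite ltn_mul2l ltn_ord.
  by rewrite mulnS !eqSS !ltn_eqF // ?subn0 ?oddM // ltnS ltnW.
- by rewrite mulnS !eqSS ltn_eqF // oddM subn0.
- by rewrite mulnS eqxx oddM /= -exprSr subn1 prednK.
Qed.

Theorem theoremC (x : rat) (l : nat) (a : seq nat) (x_gt0 : 0 < x)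
    (xa : even_cf x l a) :
  let J := lower_ideals (fence (cf_word a)) in
  cv2 (\sum_(I in J | y0 (cf_word a) \in I) q ^+ #|I|)
      (\sum_(I in J | y0 (cf_word a) \notin I) q ^+ #|I|)
  = invmx (mx2 1 0 0 q)
      *m (\prod_(i < l) (Rq ^+ nth 0%N a (2 * i) * Lq ^+ nth 0%N a (2 * i).+1))
      *m cv2 1 0.
Proof.
case: xa => l_gt0 sz_a a_ge1 _ J.
case: l l_gt0 sz_a => // l _ sz_a.
have q_neq0 : q != 0 by rewrite tofrac_eq0 polyX_eq0.
(* The matrix is triangular with determinant q, nonzero in the field of fractions. *)
have D_unit : mx2 1 0 0 q \in unitmx.
  rewrite unitmxE det_trig; last first.
    by apply/is_trig_mxP => -[[|[]]] // ? [[|[]]] // ? _; rewrite mxE.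
  by rewrite big_ord_recl big_ord1 !mxE mul1r unitfE.
rewrite -(prod_cf_word sz_a a_ge1) -!mulmxA -ideal_gf_word.
(* Moved to the left, diag(1, q) turns (A, B) into the coordinates (A, qB) of [ideal_gf_word]. *)
apply: (canRL (mulKmx D_unit)).
by rewrite mx2_mul_cv2 !mul0r mul1r addr0 add0r.
Qed.
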